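(* Let $n\ge 1$ and consider the $n$-agent repeated voting process $(V_i(t))_{i\in[n],\,t\ge 1}$ associated with $\mu_0,\mu_1$. With probability one there exist a time $T_u$ and a vote $V\in\{0,1\}$ (both may depend on the realization) such that $V_i(t)=V$ for all $t\ge T_u$ and all agents $i\in[n]$.
   Context: Signals. $\mu_0$ and $\mu_1$ are probability measures on a measurable space $(\Omega,\mathcal{O})$ such that: (1) $\mu_0$ and $\mu_1$ are mutually absolutely continuous, so that the Radon-Nikodym derivative $\frac{d\mu_1}{d\mu_0}(\omega)$ exists and is (taken to be) non-zero for all $\omega\in\Omega$; (2) if $W$ is distributed according to $\frac12\mu_0+\frac12\mu_1$ and $X=\log\frac{d\mu_1}{d\mu_0}(W)$, then the distribution of $X$ is non-atomic (no point has positive mass). Probability space. $[n]=\{1,\dots,n\}$ is the set of agents. Let $\delta_0,\delta_1$ be the point masses at $0$ and $1$ on $\{0,1\}$. The random variables $S\in\{0,1\}$ (the state of the world) and $(W_1,\dots,W_n)\in\Omega^n$ (the private signals, $W_i$ being that of agent $i$) have joint law $\mathbb{P}=\frac12\,\delta_0\otimes\mu_0^{\otimes n}+\frac12\,\delta_1\otimes\mu_1^{\otimes n}$. That is, $S$ is uniform on $\{0,1\}$ and, conditioned on $S$, the $W_i$ are i.i.d. with law $\mu_S$. Votes. For $t\in\{1,2,\dots\}$ and $i\in[n]$, the vote $V_i(t)$ is defined recursively in $t$ by $V_i(t)=1$ if $\mathbb{P}[S=1\mid W_i,\bar V^{t-1}]>1/2$ and $V_i(t)=0$ otherwise, where $\bar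 V^{t}=\{V_j(t'): j\in[n],\ 1\le t'\le t\}$ is the collection of all agents' votes up to time $t$ ($\bar V^0$ is empty). Conditional probabilities are defined up to $\mathbb{P}$-null sets. *)

(* Defs.v *)
From HB Require Import structures.
From mathcomp Require Import all_boot all_order all_algebra.
From mathcomp Require Import all_classical all_reals all_analysis.

Set Implicit Arguments.
Unset Strict Implicit.
Unset Printing Implicit Defensive.

Import Order.TTheory GRing.Theory Num.Theory.
Import numFieldNormedType.Exports.

Local Open Scope classical_set_scope.
Local Open Scope ring_scope.
Local Open Scope ereal_scope.
Local Open Scope charge_scope.

Section signals.
Context (R : realType) (d : measure_display) (Omega : measurableType d).
Variables mu0 mu1 : probability Omega R.

Definition mixture : set Omega -> \bar R :=
  measure_add (mscale ((2^-1)%:nng)%R mu0) (mscale ((2^-1)%:nng)%R mu1).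

(* The library's Radon-Nikodym derivative is one fixed version, possibly zero
   on a null set; [f] is an everywhere positive real-valued version of it. *)
Definition positive_density (f : Omega -> R) : Prop :=
  [/\ measurable_fun [set: Omega] f,
      (forall x, (0 < f x)%R) &
      ae_eq mu0 [set: Omega] (EFin \o f)
        ('d (charge_of_finite_measure mu1) '/d mu0)].

Definition non_atomic (m : set R -> \bar R) : Prop :=
  forall x : R, m [set x] = 0.

Definition log_likelihood_law (f : Omega -> R) : set R -> \bar R :=
  pushforward mixture (fun x => ln (f x)).

Definition signal_structure (f : Omega -> R) : Prop :=
  [/\ mu0 `<< mu1, mu1 `<< mu0, positive_density f &
      non_atomic (log_likelihood_law f)].

End signals.

Section voting.
Context (R : realType) (d d' : measure_display).
Context (Omega : measurableType d) (T : measurableType d').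
Variables (P : probability T R) (n : nat).

(* The joint law of (S, W_1, ..., W_n) is
   1/2 delta_0 (x) mu0^n + 1/2 delta_1 (x) mu1^n,
   expressed by its values on the events {S = s, W_1 in A_1, ..., W_n in A_n}.
   States and votes are booleans, with [true] for 1 and [false] for 0. *)
Definition signal_joint_law (mu0 mu1 : probability Omega R)
    (S : {RV P >-> bool}) (W : 'I_n -> {RV P >-> Omega}) : Prop :=
  forall (s : bool) (A : 'I_n -> set Omega), (forall i, measurable (A i)) ->
    P (S @^-1` [set s] `&` \bigcap_i (W i @^-1` A i)) =
    (2^-1)%R%:E * \prod_(i < n) (if s then mu1 else mu0) (A i).

(* [p] is a version of the conditional probability P[E | G], where [G] is a
   sub-sigma-algebra of the measurable sets of [T]. *)
Definition cond_prob_version (G : set (set T)) (E : set T) (p : T -> R) : Prop :=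
  [/\ preimage_set_system [set: T] p measurable `<=` G,
      P.-integrable [set: T] (EFin \o p) &
      forall B, G B -> \int[P]_(w in B) (p w)%:E = P (E `&` B)].

(* sigma-algebra generated by W_i and the votes V_j(t') with 1 <= t' < t *)
Definition information (W : 'I_n -> T -> Omega) (V : 'I_n -> nat -> T -> bool)
    (i : 'I_n) (t : nat) : set (set T) :=
  <<s preimage_set_system [set: T] (W i) measurable `|`
      \bigcup_(t' in [set t' | (1 <= t' < t)%N])
        \bigcup_j preimage_set_system [set: T] (V j t') measurable >>.

(* Times start at 1: the value of [V] at time 0 is irrelevant.  Conditional
   probabilities being defined up to null sets, any version may be used, and
   possibly a different one for each agent and time. *)
Definition voting_process (S : T -> bool) (W : 'I_n -> T -> Omega)
    (V : 'I_n -> nat -> T -> bool) : Prop :=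
  forall (i : 'I_n) (t : nat), (1 <= t)%N ->
    exists2 p : T -> R,
      cond_prob_version (information W V i t) (S @^-1` [set true]) p &
      forall w, V i t w = (2^-1 < p w)%R.

End voting.

(* Main.v *)
Require Import Defs.
From HB Require Import structures.
From mathcomp Require Import all_boot all_order all_algebra.
From mathcomp Require Import all_classical all_reals all_analysis.
From mathcomp Require Import measurable_realfun.
From mathcomp Require Import lra.

Set Implicit Arguments.
Unset Strict Implicit.
Unset Printing Implicit Defensive.

Import Order.TTheory GRing.Theory Num.Theory.
Import numFieldNormedType.Exports.

Local Open Scope classical_set_scope.
Local Open Scope ring_scope.

(** Write [f] for the likelihood ratio of mu1 against mu0, and work with
likelihood ratios rather than with their logarithms.

Given the common history [h] of votes, each vote of an agent only reveals on
which side of a commonly known threshold the likelihood ratio of his signal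
lies.  Hence the event that [h] is observed is a product event: the signal of
every agent [i] lies in a set [cell h i], which is the preimage under [f] of an
interval.  The evidence of agent [i] contained in [h] is
r_i = mu1 (cell h i) / mu0 (cell h i), and Bayes' rule says that [i] votes 1 iff
f (W_i) times the product of the r_j for j != i exceeds 1; writing L for the
product of all the r_j, iff f (W_i) > r_i / L.  This is
[ae_vote_by_threshold]; after it, the votes are an explicit function of the
signals and no conditional probability is left.

Fix a realization.  The cells of agent [i] decrease, and each r_i converges to a
positive limit l_i.  If the limit cell has positive mass, this is continuity
of measures.  If it is null, then the interval has shrunk to the single value
f (W_i), unless that value borders a null gap of the law of [f], which almost
surely does not happen; then l_i = f (W_i).  So L converges as well, to the
product of the l_i, and the threshold r_i / L converges to l_i / L.

The limit of L is not 1.  Otherwise the threshold of every agent [i] tends to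
l_i.  Were the limit cell of [i] of positive mass, its ratio l_i would be a mean
value of [f] on it, lying strictly between two values taken there, so that some
vote of [i] would have split the limit cell.  Hence every limit cell is null and
the product of the f (W_i) is 1, an event of probability zero since the f (W_i)
are conditionally independent with non-atomic laws.

If L tends to a limit larger than 1, then the threshold r_i / L eventually stays
a definite factor below r_i.  A vote 0 would confine the next cell to values of
[f] at most r_i / L, and thus make the next r_i drop by that factor, which is
impossible for large times because r_i converges to a positive limit.  So all
agents eventually vote 1; symmetrically they eventually vote 0 if the limit is
smaller than 1 ([votes_eventually_constant]). *)

(** * Averages over an event *)

Section averages.
Context (R : realType) (d : measure_display) (T : measurableType d).
Variable m : probability T R.

Local Lemma fineE (A : set T) : measurable A -> (fine (m A))%:E = m A.
Proof. by move=> mA; rewrite fineK// fin_num_measure. Qed.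

Variable g : T -> R.
Hypothesis ig : m.-integrable [set: T] (EFin \o g).

(** A function cannot average at most [c] over an event of positive probability
on which it exceeds [c].  This turns strict pointwise comparisons into null
events, both for densities and for conditional probabilities. *)
Lemma null_of_average_le (c : R) (B : set T) : measurable B ->
  (forall x, B x -> c < g x) ->
  (\int[m]_(x in B) (g x)%:E <= c%:E * m B)%E -> m B = 0%E.
Proof.
move=> mB cg le.
have iB : m.-integrable B (EFin \o g) by apply: integrableS ig.
have ic : m.-integrable B (EFin \o cst c).
  exact: finite_measure_integrable_cst.
have := integralB_EFin mB iB ic.
rewrite /= integral_cst// => e.
have : (\int[m]_(x in B) `|((g x)%:E - c%:E)%E| = 0)%E.
  rewrite (eq_integral (fun x => (g x)%:E - c%:E)%E).
    apply/eqP; rewrite eq_le; apply/andP; split.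
      rewrite e sube_le0//.
    apply: integral_ge0 => x Bx.
    by rewrite -EFinB lee_fin subr_ge0 ltW// cg.
  move=> x; rewrite inE => Bx.
  by rewrite gee0_abs// -EFinB lee_fin subr_ge0 ltW// cg.
move/ae_eq_integral_abs => /(_ mB) H.
have mgc := measurable_int m (integrableB mB iB ic).
have [N [mN N0 sub]] := H mgc.
apply: (subset_measure0 mB mN _ N0) => x Bx; apply: sub => /= /(_ Bx).
move/eqP; rewrite -EFinB eqe subr_eq0 => /eqP gc.
by have := cg x Bx; rewrite gc ltxx.
Qed.

Lemma average_le (c : R) (B : set T) : measurable B ->
  (forall x, B x -> g x <= c) ->
  (\int[m]_(x in B) (g x)%:E <= c%:E * m B)%E.
Proof.
move=> mB gc; have iB : m.-integrable B (EFin \o g) by apply: integrableS ig.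
have ic : m.-integrable B (EFin \o cst c).
  exact: finite_measure_integrable_cst.
rewrite -integral_cst//; apply: le_integral => //.
by move=> x; rewrite inE => Bx; rewrite lee_fin gc.
Qed.

Lemma average_ge (c : R) (B : set T) : measurable B ->
  (forall x, B x -> c <= g x) ->
  (c%:E * m B <= \int[m]_(x in B) (g x)%:E)%E.
Proof.
move=> mB gc; have iB : m.-integrable B (EFin \o g) by apply: integrableS ig.
have ic : m.-integrable B (EFin \o cst c).
  exact: finite_measure_integrable_cst.
rewrite -integral_cst//; apply: le_integral => //.
by move=> x; rewrite inE => Bx; rewrite lee_fin gc.
Qed.

End averages.

Lemma null_of_average_ge (R : realType) (d : measure_display)
    (T : measurableType d) (m : probability T R) (g : T -> R)
    (ig : m.-integrable [set: T] (EFin \o g)) (c : R) (B : set T) :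
  measurable B -> (forall x, B x -> g x < c) ->
  (c%:E * m B <= \int[m]_(x in B) (g x)%:E)%E -> m B = 0%E.
Proof.
move=> mB gc le.
have iN : m.-integrable [set: T] (EFin \o (fun x => - g x)).
  exact: (integrableN ig).
apply: (null_of_average_le iN (c := - c) mB).
  by move=> x Bx; rewrite ltrN2 gc.
have -> : (\int[m]_(x in B) (- g x)%:E = - \int[m]_(x in B) (g x)%:E)%E.
  have iB : m.-integrable B (EFin \o g) by apply: integrableS ig.
  by rewrite -integralN//; apply: integrable_add_def.
by rewrite EFinN mulNe leeN2.
Qed.

(** * Likelihood ratios of events *)

Section likelihood.
Context (R : realType) (d : measure_display) (Omega : measurableType d).
Variables (mu0 mu1 : probability Omega R) (f : Omega -> R).

(** What the argument needs from the signal structure; mutual absolute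
continuity is implied by the positivity of the density. *)
Definition likelihood_ratio : Prop :=
  [/\ measurable_fun [set: Omega] f,
      (forall x, 0 < f x),
      (forall A, measurable A -> mu1 A = (\int[mu0]_(x in A) (f x)%:E)%E) &
      (forall c, mu0 [set x | f x = c] = 0%E)].

Lemma signal_structure_likelihood_ratio :
  signal_structure mu0 mu1 f -> likelihood_ratio.
Proof.
move=> [ac01 ac10 [mf f0 fE] atom]; split=> //.
  move=> A mA.
  have ac : charge_of_finite_measure mu1 `<< mu0 by exact: ac10.
  have -> : mu1 A = charge_of_finite_measure mu1 A by [].
  rewrite (Radon_Nikodym_integral ac mA); apply: ae_eq_integral => //.
  - apply: (measurable_int mu0).
    by apply: (integrableS measurableT) => //; exact: Radon_Nikodym_integrable.
  - by apply/measurable_EFinP; exact: measurable_funTS.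
  - exact/ae_eq_sym/(ae_eq_subset _ fE).
move=> c; have [c0|c0] := leP c 0.
  (* levels outside the range of f are not seen by the law of ln f *)
  rewrite (_ : [set _ | _] = set0) ?measure0// -subset0 => x /= fc.
  by have := f0 x; rewrite fc ltNge c0.
have := atom (ln c); rewrite /log_likelihood_law /pushforward /mixture.
rewrite (_ : _ @^-1` _ = [set x | f x = c]).
  rewrite /measure_add /= /msum !big_ord_recl/= big_ord0 /mscale/= adde0.
  move/eqP; rewrite padde_eq0 ?mule_ge0 ?lee_fin ?invr_ge0//.
  case/andP; rewrite mule_eq0 eqe invr_eq0.
  by move=> /orP[|/eqP//]; rewrite pnatr_eq0.
apply/seteqP; split=> x /=.
  by apply: ln_inj; rewrite posrE.
by move=> ->.
Qed.

Hypothesis lr : likelihood_ratio.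

Let mf : measurable_fun [set: Omega] f. Proof. by case: lr. Qed.
Let f0 x : 0 < f x. Proof. by case: lr. Qed.
Let mu1E A : measurable A -> mu1 A = (\int[mu0]_(x in A) (f x)%:E)%E.
Proof. by case: lr => _ _ + _; apply. Qed.

Let intf : mu0.-integrable [set: Omega] (EFin \o f).
Proof.
apply/integrableP; split; first exact/measurable_EFinP.
rewrite (eq_integral (EFin \o f)); last first.
  by move=> x _ /=; rewrite ger0_norm// ltW.
by rewrite -mu1E// probability_setT ltry.
Qed.

(** The direction from mu1 to mu0 holds because a positive density has a positive
integral over any set of positive measure. *)
Lemma mu1_null (A : set Omega) : measurable A -> mu0 A = 0%E <-> mu1 A = 0%E.
Proof.
move=> mA; split=> A0.
  rewrite mu1E//; apply: null_set_integral => //.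
  by apply: measurable_funTS; exact/measurable_EFinP.
apply: (null_of_average_le intf (c := 0) mA) => //.
by rewrite -mu1E// A0 mul0e.
Qed.

(** The evidence carried by the event that a signal lies in [A]; equivalently the
mean of [f] on [A] under mu0, hence a value between the bounds of [f] on [A]. *)
Definition ratio (A : set Omega) : R := fine (mu1 A) / fine (mu0 A).

Lemma fine_measure_gt0 (m : probability Omega R) (A : set Omega) :
  measurable A -> m A != 0%E -> 0 < fine (m A).
Proof.
by move=> mA A0; rewrite fine_gt0// lt0e A0 measure_ge0 ltey_eq fin_num_measure.
Qed.

Lemma ratio_gt0 (A : set Omega) : measurable A -> mu0 A != 0%E -> 0 < ratio A.
Proof.
move=> mA A0; rewrite divr_gt0// fine_measure_gt0//.
by apply: contra A0 => /eqP/(mu1_null mA)/eqP.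
Qed.

Lemma mu1_le (c : R) (A : set Omega) : measurable A ->
  (forall x, A x -> f x <= c) -> fine (mu1 A) <= c * fine (mu0 A).
Proof.
move=> mA fc; rewrite -lee_fin EFinM !fineE// mu1E//.
exact: average_le.
Qed.

Lemma mu1_ge (c : R) (A : set Omega) : measurable A ->
  (forall x, A x -> c <= f x) -> c * fine (mu0 A) <= fine (mu1 A).
Proof.
move=> mA fc; rewrite -lee_fin EFinM !fineE// mu1E//.
exact: average_ge.
Qed.

Lemma ratio_le (c : R) (A : set Omega) : measurable A -> mu0 A != 0%E ->
  (forall x, A x -> f x <= c) -> ratio A <= c.
Proof.
by move=> mA A0 fc; rewrite ler_pdivrMr ?fine_measure_gt0//; exact: mu1_le.
Qed.

Lemma ratio_ge (c : R) (A : set Omega) : measurable A -> mu0 A != 0%E ->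
  (forall x, A x -> c <= f x) -> c <= ratio A.
Proof.
by move=> mA A0 fc; rewrite ler_pdivlMr ?fine_measure_gt0//; exact: mu1_ge.
Qed.

Lemma null_of_mu1_le (c : R) (A : set Omega) : measurable A ->
  (forall x, A x -> c < f x) -> fine (mu1 A) <= c * fine (mu0 A) ->
  mu0 A = 0%E.
Proof.
move=> mA fc; rewrite -lee_fin EFinM !fineE// mu1E//.
exact: null_of_average_le.
Qed.

Lemma null_of_mu1_ge (c : R) (A : set Omega) : measurable A ->
  (forall x, A x -> f x < c) -> c * fine (mu0 A) <= fine (mu1 A) ->
  mu0 A = 0%E.
Proof.
move=> mA fc; rewrite -lee_fin EFinM !fineE// mu1E//.
exact: null_of_average_ge.
Qed.

End likelihood.

(** * Values that border no null gap *)

Lemma negligible_countable (R : realType) (d : measure_display)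
    (T : measurableType d) (m : {measure set T -> \bar R})
    (I : countType) (F : I -> set T) :
  (forall i, m.-negligible (F i)) -> m.-negligible (\bigcup_i F i).
Proof.
move=> F0.
apply: (@negligibleS _ _ _ m (\bigcup_k (if unpickle k is Some i then F i else set0))).
  by move=> x [i _ Fx]; exists (pickle i) => //=; rewrite pickleK.
by apply: negligible_bigcup => k; case: unpickle => // ; exact: negligible_set0.
Qed.

Lemma ae_countable (R : realType) (d : measure_display)
    (T : measurableType d) (m : {measure set T -> \bar R})
    (I : countType) (Q : I -> T -> Prop) :
  (forall i, {ae m, forall x, Q i x}) -> {ae m, forall x, forall i, Q i x}.
Proof.
move=> Qae; apply: negligibleS (negligible_countable Qae).
by move=> x /= /existsNP[i nQ]; exists i.
Qed.

Section charged_points.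
Context (R : realType) (d : measure_display) (T : measurableType d).
Variables (m : probability T R).

(** The value [g x] is not the right end of an interval that carries no mass of
the law of [g]; [charged_right] is the mirror image. *)
Definition charged_left (g : T -> R) (x : T) : Prop :=
  forall a, a < g x -> m [set y | a < g y < g x] != 0%E.

Definition charged_right (g : T -> R) (x : T) : Prop :=
  forall b, g x < b -> m [set y | g x < g y < b] != 0%E.

Lemma measurable_between (g : T -> R) (a b : R) :
  measurable_fun [set: T] g -> measurable [set y | a < g y < b].
Proof.
move=> mg; rewrite (_ : [set _ | _] = g @^-1` `]a, b[).
  by rewrite -[X in measurable X]setTI; exact: mg.
by apply/seteqP; split=> x /=; rewrite in_itv.
Qed.

(** If [g x] has a null gap on its left, then either the gap extends beyond [g x],
so that [g x] lies in one of countably many null intervals with rational ends, or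
it is the right end of a maximal gap; there is at most one such right end
for each rational inside the gap, and single values are null. *)
Lemma ae_charged_left (g : T -> R) : measurable_fun [set: T] g ->
  (forall c, m [set x | g x = c] = 0%E) ->
  {ae m, forall x, charged_left g x}.
Proof.
move=> mg atom.
pose null q x := ratr q < g x /\ m [set y | ratr q < g y < g x] = 0%E.
pose isolated q := [set x | null q x /\ forall q' : rat,
  g x < ratr q' -> m [set y | ratr q < g y < ratr q'] != 0%E].
pose gap (q q' : rat) := [set x | ratr q < g x < ratr q' /\
  m [set y | ratr q < g y < ratr q'] = 0%E].
have gap0 q q' : m.-negligible (gap q q').
  have [e0|n0] := eqVneq (m [set y | ratr q < g y < ratr q']) 0%E.
    apply: (@negligibleS _ _ _ m [set y | ratr q < g y < ratr q']).
      by move=> x [].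
    by apply/negligibleP => //; exact: measurable_between.
  apply: (@negligibleS _ _ _ m set0); last exact: negligible_set0.
  by move=> x [_ /eqP]; rewrite (negbTE n0).
have isolated0 q : m.-negligible (isolated q).
  have [->|/set0P[x [[qx mx] ix]]] := eqVneq (isolated q) set0.
    exact: negligible_set0.
  have ml c : measurable [set x | g x = c].
    rewrite -[X in measurable X]setTI.
    exact: (mg measurableT [set c] (measurable_set1 c)).
  have level0 : m.-negligible [set y | g y = g x].
    by apply/(negligibleP _ (ml _)); exact: atom.
  apply: negligibleS level0.
  (* if g y < g z, the null gap on the left of g z covers rationals above g y *)
  have key y z : isolated q y -> null q z -> g z <= g y.
    move=> [_ iy] [qz mz]; rewrite leNgt; apply/negP => yz.
    have [q' /itvP q'P] := rat_in_itvoo yz.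
    have yq' : g y < ratr q' by rewrite q'P.
    have /eqP[] := iy q' yq'.
    apply: (subset_measure0 _ _ _ mz); try exact: measurable_between.
    move=> t /= /andP[-> tq'] /=; apply: lt_trans tq' _.
    by rewrite q'P.
  move=> y iy /=; apply/eqP; rewrite eq_le.
  by rewrite !key//; case: iy.
apply: (@negligibleS _ _ _ m
  ((\bigcup_qq gap qq.1 qq.2) `|` (\bigcup_q isolated q))); last first.
  by apply: negligibleU; apply: negligible_countable => // -[].
move=> x /= /existsNP[a /not_implyP[ax]] /negP; rewrite negbK => /eqP m0.
have [q /itvP qP] := rat_in_itvoo ax.
have nqx : null q x.
  split; first by rewrite qP.
  apply: (subset_measure0 _ _ _ m0); try exact: measurable_between.
  move=> t /= /andP[qt ->]; rewrite andbT.
  by apply: lt_trans qt; rewrite qP.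
have [ix|] := pselect (isolated q x); first by right; exists q.
move=> /not_andP[//|/existsNP[q' /not_implyP[xq']]].
move=> /negP; rewrite negbK => /eqP e; left; exists (q, q') => //=.
by split => //; case: nqx => -> _.
Qed.

Lemma ae_charged_right (g : T -> R) : measurable_fun [set: T] g ->
  (forall c, m [set x | g x = c] = 0%E) ->
  {ae m, forall x, charged_right g x}.
Proof.
move=> mg atom.
have : {ae m, forall x, charged_left (\- g) x}.
  apply: ae_charged_left; first exact: measurableT_comp.
  move=> c; rewrite -(atom (- c)); congr (m _).
  by apply/seteqP; split=> x /= ; [move=> <-; rewrite opprK|move=> ->; rewrite opprK].
apply: filterS => x cl b xb; have := cl (- b).
rewrite ltrN2 => /(_ xb); congr (m _ != _).
by apply/seteqP; split=> y /=; rewrite !ltrN2 andbC.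
Qed.

End charged_points.

(** * Likelihood ratios along nested sets *)

Section nested_ratio.
Context (R : realType) (d : measure_display) (Omega : measurableType d).
Variables (mu0 mu1 : probability Omega R) (f : Omega -> R).
Hypothesis lr : likelihood_ratio mu0 mu1 f.

(** That [A] is the preimage under [f] of an interval. *)
Definition f_convex (A : set Omega) : Prop :=
  forall x y z, A x -> A y -> f x <= f z <= f y -> A z.

Local Notation ratio := (ratio mu0 mu1).

Variable A : (set Omega)^nat.
Hypothesis mA : forall k, measurable (A k).
Hypothesis niA : nonincreasing_seq A.

Let mlimA : measurable (\bigcap_k A k).
Proof. exact: bigcapT_measurable. Qed.

Lemma fine_measure_cvg (m : probability Omega R) :
  fine (m (A k)) @[k --> \oo] --> fine (m (\bigcap_k A k)).
Proof.
apply: fine_cvg; rewrite fineK ?fin_num_measure//.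
by apply: nonincreasing_cvg_mu => //; rewrite ltey_eq fin_num_measure.
Qed.

Lemma ratio_cvg_limit_set : mu0 (\bigcap_k A k) != 0%E ->
  ratio (A k) @[k --> \oo] --> ratio (\bigcap_k A k).
Proof.
move=> A0; apply: cvgM; first exact: fine_measure_cvg.
by apply: cvgV; [rewrite gt_eqF// fine_measure_gt0|exact: fine_measure_cvg].
Qed.

(** If for some [a] below [f x] every [A k] contained a point of value at most
[a], then by convexity every [A k], hence the null limit set, would contain all
points of value between [a] and [f x], and these have positive mass.  So [f] is
eventually above [a] on [A k], and symmetrically below any [b] above [f x]; the
ratio, being a mean value of [f] on [A k], is squeezed to [f x]. *)
Lemma ratio_cvg_point (x : Omega) :
  (forall k, f_convex (A k)) -> (forall k, mu0 (A k) != 0%E) ->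
  (forall k, A k x) -> charged_left mu0 f x -> charged_right mu0 f x ->
  mu0 (\bigcap_k A k) = 0%E -> ratio (A k) @[k --> \oo] --> f x.
Proof.
move=> cA A0 Ax lx rx lim0.
have mf : measurable_fun [set: Omega] f by case: lr.
have subA j k : (j <= k)%N -> A k `<=` A j.
  by move=> jk; apply/subsetPset; exact: niA.
have low a : a < f x -> exists K, forall y, A K y -> a <= f y.
  move=> ax; apply/not_existsP => noK; have /eqP[] := lx a ax.
  apply: (subset_measure0 _ mlimA _ lim0); first exact: measurable_between.
  move=> y /= /andP[ay yx] k _.
  have /existsNP[z /not_implyP[Akz /negP]] := noK k.
  rewrite -ltNge => za; apply: (cA k z x) => //.
  by rewrite (ltW yx) andbT ltW// (lt_trans za).
have high b : f x < b -> exists K, forall y, A K y -> f y <= b.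
  move=> xb; apply/not_existsP => noK; have /eqP[] := rx b xb.
  apply: (subset_measure0 _ mlimA _ lim0); first exact: measurable_between.
  move=> y /= /andP[xy yb] k _.
  have /existsNP[z /not_implyP[Akz /negP]] := noK k.
  rewrite -ltNge => bz; apply: (cA k x z) => //.
  by rewrite (ltW xy)/= ltW// (lt_trans yb).
apply/cvgrPdist_le => /= e e0.
have [|K1 K1P] := low (f x - e); first by rewrite ltrBlDr ltrDl.
have [|K2 K2P] := high (f x + e); first by rewrite ltrDl.
exists (maxn K1 K2) => // k /=; rewrite geq_max => /andP[k1 k2].
have ge : f x - e <= ratio (A k).
  by apply: (ratio_ge lr) => // y /(subA _ _ k1); exact: K1P.
have le : ratio (A k) <= f x + e.
  by apply: (ratio_le lr) => // y /(subA _ _ k2); exact: K2P.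
by rewrite ler_distlC; apply/andP; split.
Qed.

End nested_ratio.

(** The ratio is the mean of [f] on [A], and a random variable that is almost
surely different from its mean must take values on both sides of it. *)
Lemma ratio_strictly_inside (R : realType) (d : measure_display)
    (Omega : measurableType d) (mu0 mu1 : probability Omega R) (f : Omega -> R)
    (A : set Omega) : likelihood_ratio mu0 mu1 f ->
  measurable A -> mu0 A != 0%E ->
  (exists2 x, A x & f x < ratio mu0 mu1 A) /\
  (exists2 x, A x & ratio mu0 mu1 A < f x).
Proof.
move=> lr mA A0; have [mf _ _ atom] := lr.
set c := ratio _ _ _.
have mlev : measurable [set x | f x = c].
  rewrite -[X in measurable X]setTI.
  exact: (mf measurableT [set c] (measurable_set1 c)).
have lev0 : mu0 [set x | f x = c] = 0%E by exact: atom.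
have lev1 : mu1 [set x | f x = c] = 0%E by apply/(mu1_null lr).
have mB : measurable (A `\` [set x | f x = c]) by exact: measurableD.
have drop (m : probability Omega R) : m [set x | f x = c] = 0%E ->
    m (A `\` [set x | f x = c]) = m A.
  move=> l0; rewrite measureD// ?ltey_eq ?fin_num_measure//.
  rewrite [X in (_ - X)%E](_ : _ = 0%E) ?sube0//.
  by apply: (subset_measure0 _ mlev _ l0); [exact: measurableI|move=> x []].
have e : fine (mu1 (A `\` [set x | f x = c])) =
    c * fine (mu0 (A `\` [set x | f x = c])).
  by rewrite !drop// /c /ratio divfK// gt_eqF// fine_measure_gt0.
split; apply: contrapT => no; move/eqP: A0; apply; rewrite -(drop mu0 lev0).
  apply: (null_of_mu1_le lr (c := c) mB); last by rewrite e.
  move=> x [Ax /eqP fx]; rewrite lt_neqAle eq_sym fx/= leNgt.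
  by apply/negP => xc; apply: no; exists x.
apply: (null_of_mu1_ge lr (c := c) mB); last by rewrite e.
move=> x [Ax /eqP fx]; rewrite lt_neqAle fx/= leNgt.
by apply/negP => xc; apply: no; exists x.
Qed.

(** * The voting dynamics along one realization *)

Section cells.
Context (R : realType) (d : measure_display) (Omega : measurableType d).
Variables (mu0 mu1 : probability Omega R) (f : Omega -> R) (n : nat).

Local Notation ratio := (ratio mu0 mu1).

(** By Bayes' rule, agent [i] prefers state 1 iff his own likelihood ratio times
the evidence from the other agents exceeds 1, that is, iff his likelihood ratio
exceeds this number, when agent [j] is known to have a signal in [A j]. *)
Definition threshold (A : 'I_n -> set Omega) (i : 'I_n) : R :=
  (\prod_(j < n | j != i) ratio (A j))^-1.

(** The signals of each agent compatible with a history of votes, listed with the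
latest round first. *)
Fixpoint cell (h : seq {ffun 'I_n -> bool}) : 'I_n -> set Omega :=
  if h is v :: h' then
    fun i => cell h' i `&` [set x | (threshold (cell h') i < f x) = v i]
  else fun=> setT.

Hypothesis lr : likelihood_ratio mu0 mu1 f.

Lemma measurable_above (c : R) (b : bool) : measurable [set x | (c < f x) = b].
Proof.
have [mf _ _ _] := lr.
have -> : [set x | (c < f x) = b] = (fun x => c < f x) @^-1` [set b].
  by apply/seteqP; split=> x.
rewrite -[X in measurable X]setTI.
by apply: (measurable_fun_ltr _ mf) => //; exact: measurable_cst.
Qed.

Lemma measurable_cell h i : measurable (cell h i).
Proof.
elim: h i => [i|v h IH i]/=; first exact: measurableT.
by apply: measurableI => //; exact: measurable_above.
Qed.

Lemma f_convex_cell h i : f_convex f (cell h i).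
Proof.
elim: h => [//|v h IH]/= x y z [hx vx] [hy vy] /andP[xz zy].
split; first by apply: (IH x y) => //; rewrite xz zy.
move: vx vy => /=; case: (v i) => vx vy.
  exact: lt_le_trans xz.
by apply: contraFF vy => /lt_le_trans; apply.
Qed.

Lemma cvg_prod_seq (I : Type) (r : seq I) (u : I -> nat -> R) (l : I -> R) :
  (forall i, u i k @[k --> \oo] --> l i) ->
  \prod_(i <- r) u i k @[k --> \oo] --> \prod_(i <- r) l i.
Proof.
move=> ul; elim: r => [|i r IH].
  rewrite big_nil (_ : (fun k => \prod_(i <- [::]) u i k) = fun=> 1).
    exact: cvg_cst.
  by apply/funext => k; rewrite big_nil.
rewrite big_cons (_ : (fun k => \prod_(j <- i :: r) u j k) =
  fun k => u i k * \prod_(j <- r) u j k); first exact: cvgM.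
by apply/funext => k; rewrite big_cons.
Qed.

(** The deterministic core: votes that follow the threshold rule become unanimous,
for signals that border no null gap, lie in cells of positive mass, and have a
product of likelihood ratios different from 1. *)
Lemma votes_eventually_constant (h : nat -> seq {ffun 'I_n -> bool})
    (v : nat -> {ffun 'I_n -> bool}) (x : 'I_n -> Omega) :
  h 0%N = [::] -> (forall k, h k.+1 = v k :: h k) ->
  (forall k i, v k i = (threshold (cell (h k)) i < f (x i))) ->
  (forall k i, mu0 (cell (h k) i) != 0%E) ->
  (forall i, charged_left mu0 f (x i)) ->
  (forall i, charged_right mu0 f (x i)) ->
  \prod_(i < n) f (x i) != 1 ->
  exists b, \forall k \near \oo, forall i, v k i = b.
Proof.
move=> h0 hS vE A0 xl xr prod1; have [_ f0 _ _] := lr.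
pose A i k := cell (h k) i.
have mA i k : measurable (A i k) by exact: measurable_cell.
have AS i k : A i k.+1 = A i k `&` [set y | (threshold (A^~ k) i < f y) = v k i].
  by rewrite /A hS.
have niA i : nonincreasing_seq (A i).
  apply/nonincreasing_seqP => k; rewrite AS; apply/subsetPset; exact: subIsetl.
have Ax k i : A i k (x i).
  by elim: k => [|k IH]; [rewrite /A h0|rewrite AS; split=> //=; rewrite -vE].
have r0 i k : 0 < ratio (A i k) by exact: (ratio_gt0 lr (mA i k) (A0 k i)).
have mlim i : measurable (\bigcap_k A i k) by exact: bigcapT_measurable.
have /choice[l lP] : forall i, exists l, [/\ ratio (A i k) @[k --> \oo] --> l, 0 < l,
    mu0 (\bigcap_k A i k) = 0%E -> l = f (x i) &
    mu0 (\bigcap_k A i k) != 0%E -> l = ratio (\bigcap_k A i k)].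
  move=> i; have [e|ne] := eqVneq (mu0 (\bigcap_k A i k)) 0%E.
    exists (f (x i)); split => //.
    have cA k : f_convex f (A i k) by exact: f_convex_cell.
    exact: (ratio_cvg_point lr (mA i) (niA i) cA (A0^~ i) (Ax^~ i)).
  exists (ratio (\bigcap_k A i k)); split => //.
  - exact: ratio_cvg_limit_set.
  - exact: (ratio_gt0 lr).
  - by move=> e; rewrite e eqxx in ne.
pose L := \prod_(i < n) l i.
have L0 : 0 < L by apply: prodr_gt0 => i _; case: (lP i).
have thrE i k : threshold (A^~ k) i = ratio (A i k) / \prod_(j < n) ratio (A j k).
  by rewrite /threshold [in RHS](bigD1 i)//= invfM mulrA divff ?mul1r// gt_eqF.
have cvg_thr i : threshold (A^~ k) i @[k --> \oo] --> l i / L.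
  rewrite (_ : (fun k => _) =
    fun k => ratio (A i k) / \prod_(j < n) ratio (A j k)); last exact/funext.
  apply: cvgM; first by case: (lP i).
  apply: cvgV; first by rewrite gt_eqF.
  by apply: cvg_prod_seq => j; case: (lP j).
have cvg_next i : ratio (A i k.+1) @[k --> \oo] --> l i.
  by rewrite (cvg_shiftS (fun k => ratio (A i k))); case: (lP i).
have L1 : L != 1.
  apply: contra prod1 => /eqP L1; rewrite -[X in _ == X]L1.
  apply/eqP; apply: eq_bigr => i _.
  have [_ _ + limN0] := lP i.
  have [e0 <-//|ne0 _] := eqVneq (mu0 (\bigcap_k A i k)) 0%E.
  have [[y yA yl] [z zA zl]] := ratio_strictly_inside lr (mlim i) ne0.
  (* the threshold tends to l i, so it separates y from z at some round, though
     both points survive in all the cells *)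
  rewrite -limN0// in yl zl.
  move: (cvg_thr i); rewrite L1 divr1 => thrl.
  have [k [yk kz]] : exists k, f y < threshold (A^~ k) i /\ threshold (A^~ k) i < f z.
    have := filterI (cvgr_gt _ thrl _ yl) (cvgr_lt _ thrl _ zl).
    by move=> [K _ KP]; exists K; have := KP K (leqnn K).
  have := yA k.+1 I; have := zA k.+1 I; rewrite AS => -[_ /= <-].
  by move=> [_ /=]; rewrite kz ltNge (ltW yk).
move: L1; rewrite neq_lt => /orP[L1|L1].
  exists false; apply: filter_forall => i.
  (* a vote 1 at a late round would raise the ratio at the next round above the
     midpoint of l i and l i / L *)
  have lL : l i < l i / L.
    by rewrite ltr_pdivlMr// gtr_pMr//; case: (lP i).
  have [m1 m2] := midf_lt lL.
  have near1 : \forall k \near \oo, ratio (A i k.+1) < (l i + l i / L) / 2.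
    exact: cvgr_lt (cvg_next i) _ m1.
  have near2 : \forall k \near \oo, (l i + l i / L) / 2 < threshold (A^~ k) i.
    exact: cvgr_gt (cvg_thr i) _ m2.
  move: near1 near2; apply: filterS2 => k /= k1 k2.
  apply: contraTF (lt_trans k1 k2); rewrite -leNgt.
  move=> vki; apply: (ratio_ge lr) => //; first exact: A0.
  by move=> y; rewrite AS => -[_ /=]; rewrite vki; exact: ltW.
exists true; apply: filter_forall => i.
(* a vote 0 at a late round would lower the ratio at the next round below the
   midpoint of l i / L and l i *)
have lL : l i / L < l i.
  by rewrite ltr_pdivrMr// ltr_pMr//; case: (lP i).
have [m1 m2] := midf_lt lL.
have near1 : \forall k \near \oo, (l i / L + l i) / 2 < ratio (A i k.+1).
  exact: cvgr_gt (cvg_next i) _ m2.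
have near2 : \forall k \near \oo, threshold (A^~ k) i < (l i / L + l i) / 2.
  exact: cvgr_lt (cvg_thr i) _ m1.
move: near1 near2; apply: filterS2 => k /= k1 k2.
apply: contraTT (lt_trans k2 k1); rewrite -leNgt => /negbTE vki.
apply: (ratio_le lr) => //; first exact: A0.
by move=> y; rewrite AS => -[_ /=]; rewrite vki => /negbT; rewrite -leNgt.
Qed.

End cells.

(** * Independence of the signals *)

Section pushforward_of_finite_measure.
Context (R : realType) (d1 d2 : measure_display).
Context (T : measurableType d1) (T' : measurableType d2).
Variables (Q : {finite_measure set T -> \bar R}) (Y : {mfun T >-> T'}).

(** A name for the pushforward, so that it can carry the structure of a finite
measure. *)
Definition image_measure : set T' -> \bar R := pushforward Q Y.

Let image0 : image_measure set0 = 0%E.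
Proof. exact: measure0. Qed.

Let image_ge0 A : (0 <= image_measure A)%E.
Proof. exact: measure_ge0. Qed.

Let image_sigma_additive : semi_sigma_additive image_measure.
Proof. exact: measure_semi_sigma_additive. Qed.

HB.instance Definition _ := isMeasure.Build _ _ _ image_measure
  image0 image_ge0 image_sigma_additive.

Let image_fin : fin_num_fun image_measure.
Proof.
move=> A mA; apply: fin_num_measure.
by rewrite -[X in measurable X]setTI; exact: measurable_funPT.
Qed.

HB.instance Definition _ := Measure_isFinite.Build _ _ _ image_measure image_fin.

End pushforward_of_finite_measure.

(** The joint law of independent variables is a product measure, which by Fubini
does not charge a set with null sections.  The measure [Q] is not normalized: it
will be the restriction of a probability to one state of the world. *)
Lemma null_of_null_sections (R : realType) (d1 d2 d3 : measure_display)
    (T : measurableType d1) (X : measurableType d2) (Z : measurableType d3)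
    (Q : {finite_measure set T -> \bar R}) (m : probability X R)
    (U : {mfun T >-> X}) (Y : {mfun T >-> Z}) (E : set (Z * X)) :
  (forall (C : set X) (D : set Z), measurable C -> measurable D ->
    Q (Y @^-1` D `&` U @^-1` C) = (Q (Y @^-1` D) * m C)%E) ->
  measurable E -> (forall y, m (xsection E y) = 0%E) ->
  Q [set w | E (Y w, U w)] = 0%E.
Proof.
move=> ind mE E0.
have mYU : measurable_fun [set: T] (fun w => (Y w, U w)).
  by apply: measurable_fun_pair.
have mYU' : (fun w => (Y w, U w)) \in mfun by rewrite inE; exact/mYU.
pose joint : {measure set (Z * X) -> \bar R} :=
  image_measure Q (mfun_Sub mYU').
transitivity ((image_measure Q Y \x m)%E E).
  apply/esym/(product_measure_unique (m' := joint)) => // D C mD mC.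
  exact: ind.
rewrite /product_measure1.
by apply: integral0_eq => y _ /=; rewrite E0.
Qed.

Section signal_law.
Context (R : realType) (d d' : measure_display).
Context (Omega : measurableType d) (T : measurableType d').
Variables (mu0 mu1 : probability Omega R) (f : Omega -> R).
Variables (P : probability T R) (n : nat).
Variables (S : {RV P >-> bool}) (W : 'I_n -> {RV P >-> Omega}).
Hypothesis law : signal_joint_law mu0 mu1 S W.
Hypothesis lr : likelihood_ratio mu0 mu1 f.

Definition signal_measure (s : bool) : probability Omega R :=
  if s then mu1 else mu0.

Local Notation mu := signal_measure.

Lemma measurable_state (s : bool) : measurable (S @^-1` [set s]).
Proof. by rewrite -[X in measurable X]setTI; exact: measurable_funPT. Qed.

Lemma measurable_signal i (A : set Omega) :
  measurable A -> measurable (W i @^-1` A).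
Proof. by move=> mA; rewrite -[X in measurable X]setTI; exact: measurable_funPT. Qed.

Lemma measurable_signals (A : 'I_n -> set Omega) :
  (forall i, measurable (A i)) -> measurable (\bigcap_i (W i @^-1` A i)).
Proof.
move=> mA; apply: fin_bigcap_measurable; first exact: finite_finset.
by move=> i _; exact: measurable_signal.
Qed.

Lemma probability_signals (s : bool) (A : 'I_n -> set Omega) :
  (forall i, measurable (A i)) ->
  P (S @^-1` [set s] `&` \bigcap_i (W i @^-1` A i)) =
    (2^-1 * \prod_(i < n) fine (mu s (A i)))%:E.
Proof.
move=> mA; rewrite law// EFinM; congr (_ * _)%E.
rewrite (big_morph EFin EFinM erefl); apply: eq_bigr => i _.
by rewrite /mu; case: s; rewrite fineE.
Qed.

Lemma measure_state_split (B : set T) : measurable B ->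
  P B = (P (S @^-1` [set false] `&` B) + P (S @^-1` [set true] `&` B))%E.
Proof.
move=> mB; rewrite -measureU; last 3 first.
- by apply: measurableI => //; exact: measurable_state.
- by apply: measurableI => //; exact: measurable_state.
- by rewrite -subset0 => w /= [[-> _] []].
by congr (P _); apply/seteqP; split=> [w Bw|w [[]|[]]]//=; case: (S w); [right|left].
Qed.

Lemma probability_signals_total (A : 'I_n -> set Omega) :
  (forall i, measurable (A i)) ->
  P (\bigcap_i (W i @^-1` A i)) =
    (2^-1 * (\prod_(i < n) fine (mu0 (A i)) + \prod_(i < n) fine (mu1 (A i))))%:E.
Proof.
move=> mA; rewrite measure_state_split; last exact: measurable_signals.
by rewrite !probability_signals// -EFinD mulrDr.
Qed.

Lemma null_signals (A : 'I_n -> set Omega) (i : 'I_n) :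
  (forall j, measurable (A j)) -> mu0 (A i) = 0%E ->
  P (\bigcap_j (W j @^-1` A j)) = 0%E.
Proof.
move=> mA A0; rewrite probability_signals_total// (bigD1 i)//= [X in _ + X](bigD1 i)//=.
by rewrite A0 (iffLR (mu1_null lr (mA i)) A0) /= !mul0r addr0 mulr0.
Qed.

(** The law of [W i] is the mean of mu0 and mu1, which have the same null sets. *)
Lemma negligible_signal (i : 'I_n) (A : set Omega) :
  mu0.-negligible A -> P.-negligible (W i @^-1` A).
Proof.
move=> [N [mN N0 AN]].
exists (W i @^-1` N); split; first exact: measurable_signal; last first.
  by move=> w; exact: AN.
rewrite -(@null_signals (fun j => if j == i then N else setT) i).
- congr (P _); apply/seteqP; split=> [w Nw j _|w /(_ i I)] /=; last by rewrite eqxx.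
  by case: eqP => [->|].
- by move=> j; case: ifP => // _; exact: measurableT.
- by rewrite eqxx.
Qed.

Lemma ae_signal (i : 'I_n) (Q : Omega -> Prop) :
  {ae mu0, forall x, Q x} -> {ae P, forall w, Q (W i w)}.
Proof. exact: negligible_signal. Qed.

Lemma probability_signals_at (i : 'I_n) (s : bool) (C : set Omega)
    (A : 'I_n -> set Omega) : measurable C -> (forall j, measurable (A j)) ->
  P (S @^-1` [set s] `&`
      (W i @^-1` C `&` \bigcap_(j in [set j | j != i]) (W j @^-1` A j))) =
    (2^-1 * (fine (mu s C) * \prod_(j < n | j != i) fine (mu s (A j))))%:E.
Proof.
move=> mC mA; pose A' j := if j == i then C else A j.
have mA' j : measurable (A' j) by rewrite /A'; case: ifP.
have -> : W i @^-1` C `&` \bigcap_(j in [set j | j != i]) (W j @^-1` A j) =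
    \bigcap_j (W j @^-1` A' j).
  apply/seteqP; split=> [w [Cw Aw] j _|w Aw].
    by rewrite /A'; case: eqP => [->//|/eqP ji]; exact: Aw.
  split; first by have := Aw i I; rewrite /A' eqxx.
  by move=> j /= /negbTE ji; have := Aw j I; rewrite /A' ji.
rewrite probability_signals// (bigD1 i)//= /A' eqxx.
by congr (_ * (_ * _))%:E; apply: eq_bigr => j /negbTE ->.
Qed.

(** A family of events, stable under intersection, that generates the sigma-algebra
of the signals of all agents but [i]. *)
Definition other_signals (i : 'I_n) : set (set T) :=
  [set B | exists2 A : 'I_n -> set Omega, (forall j, measurable (A j)) &
    B = \bigcap_(j in [set j | j != i]) (W j @^-1` A j)].

(** The joint law is given on product events only; both sides are finite measures
in [B], so their equality extends from the generating events. *)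
Lemma signal_independent (i : 'I_n) (s : bool) (C : set Omega) (B : set T) :
  measurable C ->
  <<s other_signals i >> B ->
  P (S @^-1` [set s] `&` (B `&` W i @^-1` C)) =
    (P (S @^-1` [set s] `&` B) * mu s C)%E.
Proof.
move=> mC; set G := other_signals i => GB.
have mSC : measurable (S @^-1` [set s] `&` W i @^-1` C).
  by apply: measurableI; [exact: measurable_state|exact: measurable_signal].
pose m1 := mrestr P mSC.
have fC : 0 <= fine (mu s C) by exact: fine_ge0.
pose m2 := mscale (NngNum fC) (mrestr P (measurable_state s)).
have GT : G setT.
  exists (fun=> setT) => //; apply/esym.
  by apply: bigcapT => *; rewrite preimage_setT.
have mG B' : G B' -> measurable B'.
  move=> [A mA ->]; apply: fin_bigcap_measurable; first exact: finite_finset.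
  by move=> j _; exact: measurable_signal.
suff : m1 B = m2 B.
  rewrite /m1 /m2 /mscale /mrestr /= fineE// => e.
  rewrite muleC [S @^-1` _ `&` B]setIC -e; congr (P _).
  by rewrite setICA.
apply: (g_sigma_algebra_measure_unique G mG (fun=> setT)) => //.
- by rewrite bigcup_const//; exists 0%N.
- move=> _ _ [A mA ->] [A' mA' ->].
  exists (fun j => A j `&` A' j); first by move=> j; exact: measurableI.
  by rewrite -bigcapI.
- move=> _ [A mA ->]; set V := \bigcap_(j in _) _.
  change (P (V `&` (S @^-1` [set s] `&` W i @^-1` C)) =
    ((fine (mu s C))%:E * P (V `&` S @^-1` [set s]))%E).
  have -> : V `&` (S @^-1` [set s] `&` W i @^-1` C) =
      S @^-1` [set s] `&` (W i @^-1` C `&` V) by rewrite setIC setIA.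
  have -> : V `&` S @^-1` [set s] = S @^-1` [set s] `&` (W i @^-1` setT `&` V).
    by rewrite preimage_setT setTI setIC.
  rewrite !probability_signals_at// -EFinM probability_setT/= mul1r.
  by congr EFin; rewrite mulrCA.
- by move=> _; rewrite /= ltey_eq fin_num_measure.
Qed.

Lemma other_signals_prod (i : 'I_n) (D : set R) : measurable D ->
  <<s other_signals i >>
    ((fun w => \prod_(j < n | j != i) f (W j w)) @^-1` D).
Proof.
move=> mD; have [mf _ _ _] := lr.
pose T' := g_sigma_algebraType (other_signals i).
have mW j : j != i -> measurable_fun [set: T'] (W j : T' -> Omega).
  move=> ji _ C mC; rewrite setTI; apply: sub_sigma_algebra.
  exists (fun k => if k == j then C else setT).
    by move=> k; case: ifP.
  apply/seteqP; split=> [w Cw k _ /=|w /(_ j ji)]; last by rewrite /= eqxx.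
  by case: eqP => [->|].
have mY : measurable_fun [set: T']
    (fun w : T' => \prod_(j < n) (if j != i then f (W j w) else 1)).
  apply: measurable_prod => j _; case: (boolP (j != i)) => ji.
    by apply: measurableT_comp => //; exact: mW.
  exact: measurable_cst.
have := mY measurableT D mD; rewrite setTI.
by under eq_fun do rewrite -big_mkcond.
Qed.

(** Given the state and the signals of the others, the product equals 1 for a
single value of [f (W i)], and no value has positive mass. *)
Lemma ae_prod_neq1 (i : 'I_n) : {ae P, forall w, \prod_(j < n) f (W j w) != 1}.
Proof.
have [mf _ _ atom] := lr.
pose Y w := \prod_(j < n | j != i) f (W j w).
have mY : measurable_fun [set: T] Y.
  move=> _ D mD; rewrite setTI.
  have : <<s other_signals i >> `<=` measurable.
    apply: smallest_sub; first exact: sigma_algebra_measurable.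
    move=> _ [A mA ->]; apply: fin_bigcap_measurable; first exact: finite_finset.
    by move=> j _; exact: measurable_signal.
  by apply; exact: other_signals_prod.
have mY' : Y \in mfun by rewrite inE; exact/mY.
pose E := [set yx : R * Omega | f yx.2 * yx.1 = 1].
have mE : measurable E.
  have mg : measurable_fun [set: R * Omega] (fun yx => f yx.2 * yx.1).
    apply: measurable_funM => //; exact: measurableT_comp.
  by have := mg measurableT [set 1] (measurable_set1 1); rewrite setTI.
have prodE w : \prod_(j < n) f (W j w) = f (W i w) * Y w.
  by rewrite (bigD1 i).
pose B := [set w | E (Y w, W i w)].
have mB : measurable B.
  have mYW : measurable_fun [set: T] (fun w => (Y w, W i w)).
    exact: measurable_fun_pair.
  by have := mYW measurableT E mE; rewrite setTI.
have B0 s : P (S @^-1` [set s] `&` B) = 0%E.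
  rewrite setIC -[LHS]/(mrestr P (measurable_state s) B).
  apply: (null_of_null_sections (m := signal_measure s) (U := W i)
    (Y := mfun_Sub mY')) => //.
    move=> C D mC mD.
    change (P ((Y @^-1` D `&` W i @^-1` C) `&` S @^-1` [set s]) =
      (P (Y @^-1` D `&` S @^-1` [set s]) * mu s C)%E).
    rewrite setIC signal_independent//; last exact: other_signals_prod.
    by rewrite setIC.
  move=> y; have lev : mu s [set x | f x = y^-1] = 0%E.
    rewrite /mu; case: (s) => //; apply/(mu1_null lr) => //.
    by have := mf measurableT [set y^-1] (measurable_set1 _); rewrite setTI.
  apply: (subset_measure0 _ _ _ lev).
  - exact: measurable_xsection.
  - by have := mf measurableT [set y^-1] (measurable_set1 _); rewrite setTI.
  - move=> x /xsectionP /= e.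
    have y0 : y != 0 by apply: contra_eq_neq e => ->; rewrite mulr0 eq_sym oner_eq0.
    by rewrite -[f x]mulr1 -(mulfV y0) mulrA e mul1r.
exists B; split => //.
  by rewrite measure_state_split// !B0 adde0.
by move=> w /= /negP; rewrite negbK prodE => /eqP.
Qed.

End signal_law.

(** * Bayesian votes follow the threshold rule *)

Lemma le_measure_ae (R : realType) (d : measure_display) (T : measurableType d)
    (P : probability T R) (A B : set T) : measurable A -> measurable B ->
  {ae P, forall w, A w -> B w} -> (P A <= P B)%E.
Proof.
move=> mA mB [N [mN N0 subN]].
apply: (@le_trans _ _ (P (B `|` N))).
  apply: le_measure; rewrite ?inE//; first exact: measurableU.
  move=> w Aw; have [Bw|nBw] := pselect (B w); [by left|right].
  by apply: subN => /= /(_ Aw).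
apply: (le_trans (measureU2 _ mB mN)).
by rewrite [X in (_ + X)%E](_ : _ = 0%E) ?adde0.
Qed.

Lemma eq_measure_ae (R : realType) (d : measure_display) (T : measurableType d)
    (P : probability T R) (A B : set T) : measurable A -> measurable B ->
  {ae P, forall w, A w <-> B w} -> P A = P B.
Proof.
move=> mA mB AB; apply/eqP; rewrite eq_le.
by apply/andP; split; apply: le_measure_ae => //; move: AB; apply: filterS => w [].
Qed.

Section history.
Context (T : Type) (n : nat).
Variable V : 'I_n -> nat -> T -> bool.

Fixpoint history (w : T) (k : nat) : seq {ffun 'I_n -> bool} :=
  if k is k'.+1 then [ffun i => V i k w] :: history w k' else [::].

Lemma size_history w k : size (history w k) = k.
Proof. by elim: k => //= k ->. Qed.

Lemma history_votes w w' k : history w k = history w' k ->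
  forall j t, (1 <= t <= k)%N -> V j t w = V j t w'.
Proof.
elim: k => [_ j [|t]//|k IH] /= [/ffunP e /IH{}IH] j t /andP[t1].
rewrite leq_eqVlt => /orP[/eqP->|tk]; first by have := e j; rewrite !ffunE.
by apply: IH; rewrite t1.
Qed.

End history.

(** Stated for an arbitrary measurable structure, since it serves both for the
events of the probability space and for those known to an agent. *)
Lemma measurable_history (d : measure_display) (T : measurableType d) (n : nat)
    (V : 'I_n -> nat -> T -> bool) (k : nat) (h : seq {ffun 'I_n -> bool}) :
  (forall j t b, (1 <= t <= k)%N -> measurable [set w | V j t w = b]) ->
  measurable [set w | history V w k = h].
Proof.
elim: k h => [|k IH] h mV /=.
  case: h => [|v h].
    by rewrite (_ : [set _ | _] = setT) //; apply/seteqP; split.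
  by rewrite (_ : [set _ | _] = set0) //; apply/seteqP; split.
case: h => [|v h].
  by rewrite (_ : [set _ | _] = set0) //; apply/seteqP; split.
rewrite (_ : [set _ | _] = \bigcap_j [set w | V j k.+1 w = v j] `&`
    [set w | history V w k = h]).
  apply: measurableI; last first.
    by apply: IH => j t b /andP[t1 tk]; apply: mV; rewrite t1 ltnW.
  apply: fin_bigcap_measurable; first exact: finite_finset.
  by move=> j _; apply: mV; rewrite ltnSn.
apply/seteqP; split=> [w /= [vE hE]|w [vE /= ->]].
  by split => // j _; rewrite /= -vE ffunE.
by congr (_ :: _); apply/ffunP => j; rewrite ffunE; exact: vE.
Qed.

(** Once the history is fixed, what an agent can distinguish is only his own
signal: the events [B] with this property form a sigma-algebra that contains
both the events about [W i] and those about past votes. *)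
Lemma information_trace (d d' : measure_display) (Omega : measurableType d)
    (T : measurableType d') (n : nat) (W : 'I_n -> T -> Omega)
    (V : 'I_n -> nat -> T -> bool) (i : 'I_n) (k : nat)
    (h : seq {ffun 'I_n -> bool}) (B : set T) :
  information W V i k.+1 B ->
  exists2 C, measurable C & B `&` [set w | history V w k = h] =
    W i @^-1` C `&` [set w | history V w k = h].
Proof.
set E := [set w | _].
pose H := [set B | exists2 C, measurable C & B `&` E = W i @^-1` C `&` E].
suff : information W V i k.+1 `<=` H by apply.
apply: smallest_sub.
  split.
  - by exists set0 => //; rewrite preimage_set0.
  - move=> A [C mC AE]; exists (~` C); first exact: measurableC.
    have same w : E w -> A w <-> C (W i w).
      move=> Ew; have [AC CA] : (A `&` E) w <-> (W i @^-1` C `&` E) w by rewrite AE.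
      by split=> [Aw|Cw]; [case: AC|case: CA].
    apply/seteqP; split=> [w [[_ nA] Ew]|w [nC Ew]]; split => //.
      by move=> /(same _ Ew).
    by split => // /(same _ Ew).
  - move=> F HF.
    have /choice[C CP] j : exists C, measurable C /\ F j `&` E = W i @^-1` C `&` E.
      by have [C ? ?] := HF j; exists C.
    exists (\bigcup_j C j).
      by apply: bigcupT_measurable => j; case: (CP j).
    rewrite preimage_bigcup !setI_bigcupl; apply: eq_bigcupr => j _.
    by case: (CP j).
move=> A [[C mC <-]|[t /= tk [j _ [D mD <-]]]].
  by exists C => //; rewrite setTI.
have [[w0 E0]|noE] := pselect (exists w, E w); last first.
  by exists set0 => //; apply/seteqP; split=> w [_ Ew]; case: noE; exists w.
have sameV w : E w -> V j t w = V j t w0.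
  move=> Ew; apply: (@history_votes _ _ V w w0 k) => //.
  by rewrite /E/= in Ew E0; rewrite Ew E0.
have [D0|D0] := pselect (D (V j t w0)).
  exists setT => //; rewrite preimage_setT !setTI.
  by apply/seteqP; split=> w; [case|move=> Ew; split => //=; rewrite sameV].
exists set0 => //; rewrite preimage_set0 set0I setTI.
by rewrite -subset0 => w [/= + Ew]; rewrite sameV.
Qed.

Section vote_rule.
Context (R : realType) (d d' : measure_display).
Context (Omega : measurableType d) (T : measurableType d').
Variables (mu0 mu1 : probability Omega R) (f : Omega -> R).
Variables (P : probability T R) (n : nat).
Variables (S : {RV P >-> bool}) (W : 'I_n -> {RV P >-> Omega}).
Hypothesis law : signal_joint_law mu0 mu1 S W.
Hypothesis lr : likelihood_ratio mu0 mu1 f.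
Variable V : 'I_n -> nat -> T -> bool.
Hypothesis HV : voting_process P S W V.

Local Notation mu := (signal_measure mu0 mu1).
Local Notation cell := (cell mu0 mu1 f).
Local Notation threshold := (threshold mu0 mu1).

Definition vote_by_threshold (k : nat) (w : T) : Prop :=
  forall i, V i k.+1 w = (threshold (cell (history V w k)) i < f (W i w)).

(** Along realizations that obey the threshold rule, observing a history is a
product event in the signals. *)
Lemma history_cell (k : nat) (h : seq {ffun 'I_n -> bool}) (w : T) :
  size h = k -> (forall k', (k' < k)%N -> vote_by_threshold k' w) ->
  history V w k = h <-> (\bigcap_j (W j @^-1` cell h j)) w.
Proof.
elim: h k => [|v h IH] [|k]//= [hk] rule.
have {}IH := IH k hk (fun k' k'k => rule k' (ltnW k'k)).
have rulek := rule k (ltnSn k).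
split=> [[vE hE] j _|Wc].
  split; first exact: (IH.1 hE).
  by rewrite /= -vE -hE ffunE rulek.
have hE : history V w k = h by apply: IH.2 => j _; case: (Wc j I).
congr (_ :: _) => //; apply/ffunP => j; rewrite ffunE rulek hE.
by case: (Wc j I).
Qed.

Lemma vote_event i k b : (1 <= k)%N ->
  measurable [set w | V i k w = b] /\ information W V i k [set w | V i k w = b].
Proof.
move=> k1; have [p [pinfo ip _] VE] := HV i k1.
pose U := [set y : R | (2^-1 < y) = b].
have mU : measurable U.
  have m2 : measurable_fun [set: R] (fun y : R => 2^-1 < y).
    by apply: measurable_fun_ltr.
  by have := m2 measurableT [set b] I; rewrite setTI.
have eU : [set w | V i k w = b] = p @^-1` U.
  by apply/seteqP; split=> w; rewrite /U /= VE.
have mp : measurable_fun [set: T] p by exact/measurable_EFinP/(measurable_int P).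
rewrite eU; split; first by have := mp measurableT U mU; rewrite setTI.
by apply: pinfo; exists U => //; rewrite setTI.
Qed.

Lemma measurable_history_event k h : measurable [set w | history V w k = h].
Proof.
by apply: measurable_history => j t b /andP[t1 _]; case: (vote_event j b t1).
Qed.

Lemma information_history i k h :
  information W V i k.+1 [set w | history V w k = h].
Proof.
set G : set (set T) := preimage_set_system [set: T] (W i) measurable `|`
  \bigcup_(t' in [set t' | (1 <= t' < k.+1)%N])
    \bigcup_j preimage_set_system [set: T] (V j t') measurable.
apply: (@measurable_history _ (g_sigma_algebraType G)) => j t b t1k.
apply: sub_sigma_algebra; right; exists t => //; exists j => //.
by exists [set b] => //; rewrite setTI.
Qed.

Lemma informationI i k (A B : set T) : information W V i k A ->
  information W V i k B -> information W V i k (A `&` B).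
Proof.
set G : set (set T) := preimage_set_system [set: T] (W i) measurable `|`
  \bigcup_(t' in [set t' | (1 <= t' < k)%N])
    \bigcup_j preimage_set_system [set: T] (V j t') measurable.
exact: (@measurableI _ (g_sigma_algebraType G)).
Qed.

Lemma information_signal i k (C : set Omega) : measurable C ->
  information W V i k (W i @^-1` C).
Proof.
by move=> mC; apply: sub_sigma_algebra; left; exists C => //; rewrite setTI.
Qed.

Lemma probability_cells i s (C : set Omega) h : measurable C ->
  P (S @^-1` [set s] `&` (W i @^-1` C `&` \bigcap_j (W j @^-1` cell h j))) =
  (2^-1 * (fine (mu s (C `&` cell h i)) *
    \prod_(j < n | j != i) fine (mu s (cell h j))))%:E.
Proof.
move=> mC; rewrite -(probability_signals_at law)//; last 2 first.
- by apply: measurableI => //; exact: measurable_cell.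
- by move=> j; exact: measurable_cell.
congr (P (_ `&` _)); apply/seteqP; split=> [w [Cw Kw]|w [[Cw Kw] Kw']].
  by split=> [|j _]; [split => //; exact: Kw|exact: Kw].
split => // j _; have [->//|ji] := eqVneq j i; exact: Kw'.
Qed.

(** If the rule fails on the event [E] that the history is [h], it fails on an
event [bad] known to agent [i]; on [E] it amounts to a condition on [W i].  The
product law expresses the probability of [bad] in each state.  When the vote is 1
but [f (W i)] is at most the threshold, state 1 has at most half of the
probability of [bad] although the posterior exceeds one half there.  When the vote
is 0 but [f (W i)] is above the threshold, the posterior is at most one half, so
state 1 has at most half of the probability of [bad], although its density relative
to state 0 exceeds 1 there.  In both cases [bad] is null. *)
Lemma ae_vote_history i k h : size h = k ->
  {ae P, forall w, forall k', (k' < k)%N -> vote_by_threshold k' w} ->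
  {ae P, forall w, history V w k = h ->
    V i k.+1 w = (threshold (cell h) i < f (W i w))}.
Proof.
move=> hk rule.
pose E := [set w | history V w k = h].
pose K := \bigcap_j (W j @^-1` cell h j).
have mE : measurable E by exact: measurable_history_event.
have mK : measurable K by apply: measurable_signals => j; exact: measurable_cell.
have EK : {ae P, forall w, E w <-> K w}.
  by move: rule; apply: filterS => w; exact: history_cell.
have [[j cj0]|nocell0] := pselect (exists j, mu0 (cell h j) = 0%E).
  have E0 : P E = 0%E.
    rewrite (eq_measure_ae mE mK EK).
    by apply: (null_signals law lr _ cj0) => j'; exact: measurable_cell.
  exists E; split => // w /= /not_implyP[hE _]; exact: hE.
have cell0 j : mu0 (cell h j) != 0%E.
  by apply/eqP => e; apply: nocell0; exists j.
pose theta := threshold (cell h) i.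
suff bad0 b : P.-negligible
    [set w | [/\ V i k.+1 w = b, (theta < f (W i w)) = ~~ b & E w]].
  apply: negligibleS (negligibleU (bad0 true) (bad0 false)) => w /=.
  move=> /not_implyP[hE]; rewrite -/theta.
  by case: (V i k.+1 w); case: (theta < _) => // _; [left|right].
set bad := [set w | _].
have [p [pinfo ip pE] VE] := HV i (ltn0Sn k).
have [mVb infoVb] := vote_event i b (ltn0Sn k).
have mF : measurable [set x | (theta < f x) = ~~ b] by exact: (measurable_above lr).
have badE : bad = [set w | V i k.+1 w = b] `&`
    (W i @^-1` [set x | (theta < f x) = ~~ b] `&` E).
  by apply/seteqP; split=> w []// ? [].
have infobad : information W V i k.+1 bad.
  rewrite badE; apply: informationI => //; apply: informationI.
    exact: information_signal.
  exact: information_history.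
have mbad : measurable bad.
  rewrite badE; apply: measurableI => //; apply: measurableI => //.
  exact: measurable_signal.
have [C mC CE] := information_trace h infobad.
pose D := (C `&` [set x | (theta < f x) = ~~ b]) `&` cell h i.
have mD : measurable D.
  by apply: measurableI; [exact: measurableI|exact: measurable_cell].
pose rest s := \prod_(j < n | j != i) fine (mu s (cell h j)).
have Pbad s : P (S @^-1` [set s] `&` bad) = (2^-1 * (fine (mu s D) * rest s))%:E.
  rewrite -probability_cells; last exact: measurableI.
  have mW : measurable (W i @^-1` (C `&` [set x | (theta < f x) = ~~ b])).
    by apply: measurable_signal; exact: measurableI.
  apply: eq_measure_ae.
  - by apply: measurableI => //; exact: measurable_state.
  - by apply: measurableI; [exact: measurable_state|exact: measurableI].
  move: EK; apply: filterS => w [EKw KEw].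
  have : (bad `&` E) w <-> (W i @^-1` C `&` E) w by rewrite CE.
  move=> [bC Cb]; split=> [[Sw bw]|[Sw [[Cw Fw] Kw]]].
    have [_ Fw Ew] := bw.
    split => //; split; last exact: EKw.
    by split => //; case: bC.
  by split => //; case: Cb => //; split => //; exact: KEw.
apply/negligibleP => //.
set a0 := fine (mu0 D); set a1 := fine (mu1 D).
have Ptrue : P (S @^-1` [set true] `&` bad) = (2^-1 * (a1 * rest true))%:E.
  exact: Pbad.
have Ptot : P bad = (2^-1 * (a0 * rest false + a1 * rest true))%:E.
  by rewrite (measure_state_split S mbad) !Pbad -EFinD mulrDr.
have cell1 j : mu1 (cell h j) != 0%E.
  apply/negP => /eqP e; have := cell0 j.
  by rewrite (iffRL (mu1_null lr (measurable_cell lr h j)) e) eqxx.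
have rest0 s : 0 < rest s.
  apply: prodr_gt0 => j _; apply: fine_measure_gt0.
    exact: measurable_cell.
  by case: s; [exact: cell1|exact: cell0].
have thetaE : theta = rest false / rest true.
  by rewrite /theta /threshold /ratio prodf_div invf_div.
have leE : (a1 <= theta * a0) = (a1 * rest true <= a0 * rest false).
  by rewrite thetaE -ler_pdivlMr// [_ * a0]mulrC mulrA.
have ibad := pE bad infobad.
have [bT|bF] := boolP b.
  apply: (null_of_average_le ip (c := 2^-1) mbad).
    by move=> w [+ _ _]; rewrite VE bT.
  rewrite ibad Ptrue Ptot -EFinM lee_fin.
  have : a1 * rest true <= a0 * rest false.
    rewrite -leE; apply: (mu1_le lr mD) => x [[_ /=]].
    by rewrite bT => /negbT; rewrite -leNgt.
  lra.
have : (\int[P]_(w in bad) (p w)%:E <= (2^-1)%:E * P bad)%E.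
  apply: (average_le ip mbad) => w [+ _ _].
  by rewrite VE (negbTE bF) => /negbT; rewrite -leNgt.
rewrite ibad Ptrue Ptot -EFinM lee_fin => half.
have le10 : a1 <= theta * a0 by rewrite leE; lra.
have D0 : mu0 D = 0%E by apply: (null_of_mu1_le lr mD) le10 => x [[_ /= ->]].
have a00 : a0 = 0 by rewrite /a0 D0.
have a10 : a1 = 0 by rewrite /a1 (iffLR (mu1_null lr mD) D0).
by apply: (etrans Ptot); rewrite a00 a10 !mul0r addr0 mulr0.
Qed.

(** By induction on the round, since the shape of the history event used at one
round relies on the rule at the earlier rounds; there are countably many
histories. *)
Lemma ae_vote_by_threshold : {ae P, forall w, forall k, vote_by_threshold k w}.
Proof.
have step k : {ae P, forall w, forall k', (k' < k)%N -> vote_by_threshold k' w}.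
  elim: k => [|k IH]; first by apply: aeW.
  have : {ae P, forall w, forall ih : 'I_n * seq {ffun 'I_n -> bool},
      size ih.2 = k -> history V w k = ih.2 ->
      V ih.1 k.+1 w = (threshold (cell ih.2) ih.1 < f (W ih.1 w))}.
    apply: ae_countable => -[i h] /=.
    have [hk|hk] := eqVneq (size h) k; last by apply: aeW => w e; rewrite e eqxx in hk.
    by have := ae_vote_history i hk IH; apply: filterS => w + _.
  apply: filterS2 IH => w IHw rule k'.
  rewrite ltnS leq_eqVlt => /orP[/eqP->|]; last exact: IHw.
  move=> i; apply: (rule (i, history V w k)) => //=.
  exact: size_history.
by apply: ae_foralln => k; have := step k.+1; apply: filterS => w; apply.
Qed.

End vote_rule.

(** * Convergence to unanimity *)

Theorem theorem1p4 (R : realType)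
  (d : measure_display) (Omega : measurableType d)
  (mu0 mu1 : probability Omega R) (f : Omega -> R)
  (Hsignals : signal_structure mu0 mu1 f)
  (n : nat) (Hn : (1 <= n)%N)
  (d' : measure_display) (T : measurableType d') (P : probability T R)
  (S : {RV P >-> bool}) (W : 'I_n -> {RV P >-> Omega})
  (Hlaw : signal_joint_law mu0 mu1 S W)
  (V : 'I_n -> nat -> T -> bool)
  (HV : voting_process P S W V) :
  {ae P, forall w, exists (Tu : nat) (v : bool), (1 <= Tu)%N /\
    forall (t : nat) (i : 'I_n), (Tu <= t)%N -> V i t w = v}.
Proof.
have lr := signal_structure_likelihood_ratio Hsignals.
have [mf _ _ atom] := lr.
have rule := ae_vote_by_threshold Hlaw lr HV.
have left_ae : {ae P, forall w, forall i, charged_left mu0 f (W i w)}.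
  by apply: ae_countable => i; apply: (ae_signal Hlaw lr); exact: ae_charged_left.
have right_ae : {ae P, forall w, forall i, charged_right mu0 f (W i w)}.
  by apply: ae_countable => i; apply: (ae_signal Hlaw lr); exact: ae_charged_right.
have prod_ae := ae_prod_neq1 Hlaw lr (Ordinal Hn).
have cell_ae : {ae P, forall w, forall hi : seq {ffun 'I_n -> bool} * 'I_n,
    cell mu0 mu1 f hi.1 hi.2 (W hi.2 w) -> mu0 (cell mu0 mu1 f hi.1 hi.2) != 0%E}.
  apply: ae_countable => -[h i] /=.
  suff : {ae mu0, forall x, cell mu0 mu1 f h i x -> mu0 (cell mu0 mu1 f h i) != 0%E}.
    exact: (ae_signal Hlaw lr).
  have [c0|c0] := eqVneq (mu0 (cell mu0 mu1 f h i)) 0%E; last by apply: aeW.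
  exists (cell mu0 mu1 f h i); split => //; first exact: measurable_cell.
  by move=> x /= /not_implyP[].
apply: filterS2 (filterI rule cell_ae) (filterI (filterI left_ae right_ae) prod_ae).
move=> w [rulew cellw] [[lw rw] pw].
have inside k i : cell mu0 mu1 f (history V w k) i (W i w).
  have := history_cell (mu0 := mu0) (mu1 := mu1) (f := f) (W := W) (V := V)
    (size_history V w k) (fun k' _ => rulew k').
  by move=> [+ _] => /(_ erefl) /(_ i I).
have [b [K _ KP]] := votes_eventually_constant lr (h := history V w)
  (v := fun k => [ffun i => V i k.+1 w]) (x := W ^~ w) erefl (fun=> erefl)
  (fun k i => etrans (ffunE _ _) (rulew k i)) (fun k i => cellw (_, i) (inside k i))
  lw rw pw.
exists K.+1, b; split => // -[//|t] i Kt.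
by have := KP t Kt i; rewrite ffunE.
Qed.
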